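(* Let $n\ge 2$, $\omega=e^{2\pi\mathrm{i}/n}$, and let $\chi_1,\dots,\chi_n$ be the irreducible characters of the cyclic group $\mathbb{Z}_n$, given by $\chi_k(\bar m)=\omega^{(k-1)m}$. For $a_1,\dots,a_n\in\mathbb{C}$, the class function $f=a_1\chi_1+\cdots+a_n\chi_n$ on $\mathbb{Z}_n$ is a bent function $\mathbb{Z}_n\to\mathbb{S}^1$ if and only if $|a_1|=|a_2|=\cdots=|a_n|=\frac{1}{\sqrt n}$ and, for every $k=1,2,\dots,\lfloor n/2\rfloor$ (i.e. $k\le \frac{n-1}{2}$ if $n$ is odd and $k\le\frac n2$ if $n$ is even), $$\sum_{j=1}^{n}\overline{a_j}\,a_{j+k}=0,$$ where indices are taken modulo $n$ (so $a_{n+r}=a_r$); e.g. for $k=1$ this reads $\overline{a_1}a_2+\overline{a_2}a_3+\cdots+\overline{a_{n-1}}a_n+\overline{a_n}a_1=0$.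
   Context: $\mathbb{S}^1=\{z\in\mathbb{C}: |z|=1\}$. A class function is a function constant on conjugacy classes. For a finite group $G$ with identity $e$, a function $f:G\to\mathbb{S}^1$ is called bent if and only if $\sum_{x\in G}\overline{f(x)}f(\sigma x)=0$ for every $\sigma\in G\setminus\{e\}$ (here the group operation of $\mathbb{Z}_n$ is addition). *)

(* Defs.v *)
From HB Require Import structures.
From mathcomp Require Import all_boot all_order all_algebra all_fingroup.
From mathcomp Require Import complex.
From mathcomp Require Import reals trigo.

Set Implicit Arguments.
Unset Strict Implicit.
Unset Printing Implicit Defensive.

Import Order.TTheory GRing.Theory Num.Theory.

Local Open Scope ring_scope.
Local Open Scope complex_scope.

Definition bent (R : realType) (gT : finGroupType) (f : gT -> R[i]) : Prop :=
  (forall x : gT, `|f x| = 1) /\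
  (forall s : gT, s != 1%g -> \sum_(x : gT) (f x)^*%R * f (s * x)%g = 0).

(* exp (2 * pi * i / n), written with Euler's formula *)
Definition omega (R : realType) (n : nat) : R[i] :=
  cos (2 * pi / n%:R) +i* sin (2 * pi / n%:R).

(* Indices start at 0: with chi_1, ..., chi_n numbered from 1, chi k is
   chi_(k+1). Both k and m are read through their representatives in
   {0, ..., n-1}; 'Z_n is Z/nZ only for n >= 2. *)
Definition chi (R : realType) (n : nat) (k m : 'Z_n) : R[i] :=
  omega R n ^+ (k * m)%N.

(* Main.v *)
(* Write F for the Fourier transform on Z/n, so that the function is F a, and
   let A be the autocorrelation of a. Then |F a|^2 = F A, and the
   autocorrelation of F a is n F(|a|^2). By Fourier inversion, |F a| = 1
   everywhere iff A is the delta function at 0, and the autocorrelation of F a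
   vanishes off 0 iff |a|^2 is constant; A(0) = sum |a|^2 then fixes the
   constant to 1/n. Since A(-d) is the conjugate of A(d), the shifts
   1 <= d <= n/2 suffice. *)
Require Import Defs.
From mathcomp Require Import all_boot all_order all_algebra all_fingroup.
From mathcomp Require Import complex.
From mathcomp Require Import reals trigo.
From mathcomp Require Import ring lra zify.

Import Order.TTheory GRing.Theory Num.Theory.

Local Open Scope ring_scope.
Local Open Scope complex_scope.

Lemma omegaX (R : realType) (n k : nat) :
  omega R n ^+ k =
  cos (k%:R * (2 * pi / n%:R)) +i* sin (k%:R * (2 * pi / n%:R)).
Proof.
elim: k => [|k IHk]; first by rewrite expr0 mul0r cos0 sin0.
rewrite exprS IHk /omega -[in RHS]natr1 [in RHS]mulrDl mul1r cosD sinD.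
by congr (_ +i* _); ring.
Qed.

Lemma omega_order (R : realType) (n : nat) :
  (0 < n)%N -> omega R n ^+ n = 1.
Proof.
move=> n_gt0; have n_neq0 : (n%:R : R) != 0 by rewrite pnatr_eq0 -lt0n.
rewrite omegaX mulrC divfK // [2 * pi]mulrC mulr_natr.
by rewrite cos2pi sin2pi.
Qed.

Lemma omegaX_neq1 (R : realType) (n k : nat) :
  (0 < k < n)%N -> omega R n ^+ k != 1.
Proof.
move=> /andP[k_gt0 lt_kn].
have n_gt0 : 0 < (n%:R : R) by rewrite ltr0n (leq_trans _ lt_kn).
(* Half the argument of [omega R n ^+ k]. As [t] lies strictly between 0 and [pi], [sin t] is
   positive, so the real part cos(2t) = 1 - 2 sin(t)^2 is less than 1. *)
pose t : R := k%:R / n%:R * pi.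
have t_gt0 : 0 < t by rewrite mulr_gt0 ?pi_gt0 // divr_gt0 // ltr0n.
have t_ltpi : t < pi.
  by rewrite -[ltRHS]mul1r ltr_pM2r ?pi_gt0 // ltr_pdivrMr // mul1r ltr_nat.
have sin_gt0 : 0 < sin t by apply: sin_gt0_pi; rewrite t_gt0.
apply/eqP; rewrite omegaX.
have -> : k%:R * (2 * pi / n%:R) = t + t :> R by rewrite /t; field; rewrite gt_eqF.
case; rewrite cosD => cos1 _.
have := cos2Dsin2 t.
have := mulr_gt0 sin_gt0 sin_gt0.
rewrite expr2 expr2; lra.
Qed.

Section Fourier.
Variables (R : realType) (p : nat).
Local Notation n := p.+2.
Implicit Types (k l m d s : 'Z_n) (h a : 'Z_n -> R[i]).

Lemma chiC k m : chi R k m = chi R m k.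
Proof. by rewrite /chi mulnC. Qed.

Lemma omegaX_mod (j : nat) : omega R n ^+ (j %% n) = omega R n ^+ j.
Proof. by rewrite expr_mod // omega_order. Qed.

Lemma chiDl k l m : chi R (k + l) m = chi R k m * chi R l m.
Proof.
(* The representative of [k + l] is reduced modulo [n], so the two exponents agree only modulo
   [n]. *)
rewrite /chi -exprD -mulnDl -[LHS]omegaX_mod -[RHS]omegaX_mod.
by rewrite modnMml.
Qed.

Lemma chiDr k l m : chi R m (k + l) = chi R m k * chi R m l.
Proof. by rewrite chiC chiDl !(chiC m). Qed.

Lemma chi0l m : chi R 0 m = 1.
Proof. by rewrite /chi mul0n expr0. Qed.

(** Character values are [n]-th roots of unity, and 1 is the only nonnegative number whose [n]-th
    power is 1. *)
Lemma norm_chi k m : `|chi R k m| = 1.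
Proof.
apply/eqP; rewrite -(@pexpr_eq1 _ _ n) // -normrX /chi -exprM mulnC exprM.
by rewrite omega_order // expr1n normr1.
Qed.

Lemma chiNl k m : chi R (- k) m = (chi R k m)^*%R.
Proof.
have chi_neq0 : chi R k m != 0 by rewrite -normr_eq0 norm_chi oner_neq0.
apply: (mulfI chi_neq0); rewrite -chiDl subrr chi0l.
by rewrite -normCK norm_chi expr1n.
Qed.

Lemma sum_chi k : \sum_m chi R k m = (n * (k == 0))%:R.
Proof.
have [->|k_neq0] := eqVneq k 0.
  under eq_bigr do rewrite chi0l.
  by rewrite sumr_const card_ord muln1.
have chi1_neq1 : chi R k 1 != 1.
  rewrite /chi muln1 omegaX_neq1 //.
  by rewrite lt0n k_neq0 ltn_ord.
(* Translating [m] by 1 multiplies the sum by [chi R k 1]; a nonzero sum would force this factor to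
   be 1. *)
rewrite muln0; apply/eqP; apply: contraTT chi1_neq1 => sum_neq0.
rewrite negbK; apply/eqP/(mulIf sum_neq0); rewrite mul1r mulr_sumr.
under eq_bigr do rewrite -chiDr.
by rewrite [RHS](reindex_inj (addrI (1 : 'Z_n))).
Qed.

(** Neither conjugated nor normalized, so that the function of the theorem is literally [fourier a];
    the factor [n] appears in the inversion formula instead. *)
Definition fourier h m : R[i] := \sum_k h k * chi R k m.

Definition autocorr h d : R[i] := \sum_j (h j)^*%R * h (j + d).

Lemma fourier_inv h d :
  \sum_m fourier h m * (chi R d m)^*%R = n%:R * h d.
Proof.
under eq_bigr do rewrite mulr_suml.
rewrite exchange_big /=.
under eq_bigr => k _.
  under eq_bigr do rewrite -mulrA -chiNl -chiDl.
  rewrite -mulr_sumr sum_chi subr_eq0; over.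
rewrite (bigD1 d) //= eqxx muln1 big1 ?addr0 1?mulrC // => k /negbTE ->.
by rewrite muln0 mulr0.
Qed.

Lemma natn_neq0 : n%:R != 0 :> R[i].
Proof. by rewrite pnatr_eq0. Qed.

Lemma fourier_delta h c :
  (forall m, fourier h m = c) <-> (forall d, h d = if d == 0 then c else 0).
Proof.
split=> [hE d | hE m]; last first.
  rewrite /fourier (bigD1 0) //= hE eqxx chi0l mulr1 big1 ?addr0 // => k.
  by move=> /negbTE k_neq0; rewrite hE k_neq0 mul0r.
apply: (mulfI natn_neq0); rewrite -fourier_inv.
under eq_bigr do rewrite hE -chiNl.
rewrite -mulr_sumr sum_chi oppr_eq0.
by case: eqP => _; rewrite ?muln1 ?muln0 ?mulr0 // mulrC.
Qed.

(** Constancy of [h] is expressed as equality with its mean, since in the inversion formula only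
    frequency 0 survives. *)
Lemma fourier_const h :
  (forall s, s != 0 -> fourier h s = 0) <->
  (forall k, n%:R * h k = \sum_j h j).
Proof.
split=> [hE k | hE s s_neq0].
  rewrite -fourier_inv (bigD1 0) //= big1 ?addr0 => [|m m_neq0].
    rewrite chiC chi0l rmorph1 mulr1; apply: eq_bigr => j _.
    by rewrite chiC chi0l mulr1.
  by rewrite hE // mul0r.
apply: (mulfI natn_neq0); rewrite mulr0 mulr_sumr.
under eq_bigr do rewrite mulrA hE chiC.
by rewrite -mulr_sumr sum_chi (negbTE s_neq0) muln0 mulr0.
Qed.

Lemma norm_fourier a m : `|fourier a m| ^+ 2 = fourier (autocorr a) m.
Proof.
rewrite normCKC rmorph_sum /= mulr_suml /fourier.
under [RHS]eq_bigr do rewrite mulr_suml.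
rewrite [RHS]exchange_big /=; apply: eq_bigr => j _.
(* Substituting [j + d] for the second index splits off [chi R j m], which cancels against its
   conjugate. *)
rewrite mulr_sumr (reindex_inj (addrI j)) /=; apply: eq_bigr => d _.
rewrite rmorphM /= chiDl.
have := norm_chi j m => /(congr1 (fun x => x ^+ 2)); rewrite normCKC expr1n.
move=> chiJ; rewrite -[RHS]mulr1 -chiJ; ring.
Qed.

Lemma autocorr_fourier a s :
  autocorr (fourier a) s = n%:R * fourier (fun k => `|a k| ^+ 2) s.
Proof.
rewrite /autocorr.
under eq_bigr => x _.
  (* Only the second factor is expanded: after regrouping, the sum over [x] is the conjugate of the
     inversion formula at [k]. *)
  rewrite {2}/fourier mulr_sumr.
  under eq_bigr => k _.
    rewrite chiDr.
    have -> : (fourier a x)^*%R * (a k * (chi R k x * chi R k s)) =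
      (fourier a x * (chi R k x)^*%R)^*%R * (a k * chi R k s).
      by rewrite rmorphM /= conjCK; ring.
    over.
  over.
rewrite exchange_big /= mulr_sumr; apply: eq_bigr => k _.
rewrite -mulr_suml -rmorph_sum fourier_inv rmorphM /= rmorph_nat normCKC.
by rewrite !mulrA.
Qed.

Lemma autocorrN a d : autocorr a (- d) = (autocorr a d)^*%R.
Proof.
rewrite /autocorr rmorph_sum /= (reindex_inj (addIr d)) /=.
by apply: eq_bigr => j _; rewrite addrK rmorphM /= conjCK mulrC.
Qed.

Lemma autocorr0 a : autocorr a 0 = \sum_j `|a j| ^+ 2.
Proof. by apply: eq_bigr => j _; rewrite addr0 normCKC. Qed.

Lemma autocorr_half a :
  (forall d, d != 0 -> autocorr a d = 0) <->
  (forall k : nat, (1 <= k <= n %/ 2)%N -> autocorr a k%:R = 0).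
Proof.
split=> [aE k /andP[k_gt0 k_le] | aE d d_neq0].
  apply: aE; rewrite -val_eqE /= Zp_nat /= modn_small; first by rewrite -lt0n.
  by apply: leq_ltn_trans k_le _; rewrite ltn_Pdiv.
have d_gt0 : (0 < d)%N by rewrite lt0n.
have d_lt : (d < n)%N := ltn_ord d.
have [d_le|d_gt] := leqP d (n %/ 2).
  by rewrite -[d]natr_Zp aE // d_gt0.
rewrite -[d]opprK autocorrN -[- d]natr_Zp aE ?rmorph0 //=.
(* The representative of [- d] is [n - d], which is at most [n %/ 2] because [d] exceeds it. *)
change (0 < (n - d) %% n <= n %/ 2)%N; rewrite modn_small; lia.
Qed.

Lemma bent_fourier a :
  bent (fourier a) <->
  (forall m, `|fourier a m| ^+ 2 = 1) /\
  (forall s, s != 0 -> autocorr (fourier a) s = 0).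
Proof.
have corrE s : \sum_(x : 'Z_n) (fourier a x)^*%R * fourier a (s * x)%g =
    autocorr (fourier a) s.
  (* The group law in [bent] is addition on ['Z_n]. *)
  by apply: eq_bigr => x _; rewrite FinRing.zmodMgE addrC.
split=> -[norm1 corr0]; split=> [m|s s_neq0].
- by rewrite norm1 expr1n.
- by rewrite -corrE corr0.
- by apply/eqP; rewrite -(@pexpr_eq1 _ _ 2) // norm1.
- by rewrite corrE corr0.
Qed.

Lemma norm_inv_sqrt (z : R[i]) :
  `|z| = (1 / Num.sqrt (n%:R : R))%:C <-> n%:R * `|z| ^+ 2 = 1.
Proof.
have sqE : (1 / Num.sqrt (n%:R : R))%:C ^+ 2 = n%:R^-1.
  rewrite -rmorphXn /= expr_div_n expr1n sqr_sqrtr ?ler0n //.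
  by rewrite mul1r fmorphV rmorph_nat.
have inv_ge0 : 0 <= (1 / Num.sqrt (n%:R : R))%:C.
  by rewrite lecR divr_ge0 ?ler01 ?sqrtr_ge0.
split=> [->|zE]; first by rewrite sqE mulfV ?natn_neq0.
apply/eqP; rewrite -(@eqrXn2 _ 2) // sqE; apply/eqP.
by apply: (mulfI natn_neq0); rewrite zE mulfV ?natn_neq0.
Qed.

Lemma bent_fourierP a :
  bent (fourier a) <->
  (forall k, `|a k| = (1 / Num.sqrt (n%:R : R))%:C) /\
  (forall k : nat, (1 <= k <= n %/ 2)%N -> autocorr a k%:R = 0).
Proof.
rewrite bent_fourier -autocorr_half.
split=> -[H1 H2].
  have /fourier_delta corrE m : fourier (autocorr a) m = 1.
    by rewrite -norm_fourier.
  split=> [k|d /negbTE d_neq0]; last by rewrite corrE d_neq0.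
  apply/norm_inv_sqrt.
  have /fourier_const -> : forall s, s != 0 ->
      fourier (fun k => `|a k| ^+ 2) s = 0.
    move=> s s_neq0; apply: (mulfI natn_neq0).
    by rewrite -autocorr_fourier H2 // mulr0.
  (* The sum of the squared moduli is the autocorrelation at 0, already known to be 1. *)
  by rewrite -autocorr0 corrE eqxx.
have a_sq k : n%:R * `|a k| ^+ 2 = 1 by apply/norm_inv_sqrt.
(* This supplies the value at shift 0, about which the vanishing conditions say nothing. *)
have sum1 : \sum_j `|a j| ^+ 2 = 1 :> R[i].
  apply: (mulfI natn_neq0); rewrite mulr_sumr.
  under eq_bigr do rewrite a_sq.
  by rewrite sumr_const card_ord mulr1.
split=> [m|s s_neq0].
  rewrite norm_fourier; move: m; apply/fourier_delta => d.
  by case: eqVneq => [->|/H2 //]; rewrite autocorr0.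
rewrite autocorr_fourier; suff -> : fourier (fun k => `|a k| ^+ 2) s = 0.
  by rewrite mulr0.
by move: s s_neq0; apply/fourier_const => k; rewrite a_sq sum1.
Qed.

End Fourier.

Theorem theorem2p4 (R : realType) (n : nat) (hn : (2 <= n)%N)
    (a : 'Z_n -> R[i]) :
  bent (fun m : 'Z_n => \sum_(k : 'Z_n) a k * chi R k m) <->
  ((forall k : 'Z_n, `|a k| = (1 / Num.sqrt (n%:R : R))%:C) /\
   (forall k : nat, (1 <= k <= n %/ 2)%N ->
      \sum_(j : 'Z_n) (a j)^*%R * a (j + k%:R) = 0)).
Proof.
(* For [n] of the form [p.+2], ['Z_n] is convertible to ['I_n]. *)
case: n hn a => [|[|p]] // _ a.
exact: bent_fourierP.
Qed.
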